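(* Let $n\in\mathbb{N}$ and let $\Delta:M_n\to M_n$ be a weak-2-local $^*$-derivation. Then $\Delta$ is bounded on the set $\mathcal{P}(M_n)$ of all projections in $M_n$, that is, $\sup\{\|\Delta(p)\| : p\in\mathcal{P}(M_n)\}<\infty$.
   Context: $M_n$ denotes the C$^*$-algebra of all $n\times n$ complex matrices; a projection is an element $p$ with $p=p^*=p^2$. A derivation on a C$^*$-algebra $A$ is a (complex) linear map $D:A\to A$ with $D(ab)=D(a)b+aD(b)$ for all $a,b\in A$; it is a $^*$-derivation if moreover $D(a^* )=D(a)^*$ for all $a\in A$. $A^*$ denotes the space of bounded linear functionals on $A$. A (not necessarily linear) mapping $\Delta:A\to A$ is a weak-2-local $^*$-derivation if for every $a,b\in A$ and every $\phi\in A^*$ there exists a $^*$-derivation $D_{a,b,\phi}:A\to A$, depending on $a$, $b$ and $\phi$, such that $\phi(\Delta(a))=\phi(D_{a,b,\phi}(a))$ and $\phi(\Delta(b))=\phi(D_{a,b,\phi}(b))$. *)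

(* Defs.v *)
From mathcomp Require Import all_boot all_order all_algebra.
From mathcomp Require Import complex.
From mathcomp Require Import all_classical all_reals all_analysis.

Set Implicit Arguments.
Unset Strict Implicit.
Unset Printing Implicit Defensive.

Import Order.TTheory GRing.Theory Num.Theory.
Import ComplexField.Normc.
Local Open Scope classical_set_scope.
Local Open Scope ring_scope.
Local Open Scope complex_scope.
Local Open Scope sesquilinear_scope.

(* [R[i]] is the field of complex numbers when [R : realType].  Its order norm
   [`|z|] takes values in [R[i]]; [normc z] is the same modulus, in [R].
   Products are written [*m], since ['M[R[i]]_n] has the multiplication [*]
   only for [n] of the form [n'.+1]. *)

Definition l2norm (R : realType) (n : nat) (v : 'cV[R[i]]_n) : R :=
  Num.sqrt (\sum_(i < n) normc (v i 0) ^+ 2).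

(* The C*-norm of M_n; library norms on matrices are entrywise. *)
Definition opnorm (R : realType) (n : nat) (a : 'M[R[i]]_n) : R :=
  sup [set l2norm (a *m v) | v in [set v : 'cV[R[i]]_n | l2norm v <= 1]].

Definition projection (R : realType) (n : nat) (p : 'M[R[i]]_n) : Prop :=
  p = p^t* /\ p = p *m p.

Definition derivation (R : realType) (n : nat)
    (D : {linear 'M[R[i]]_n -> 'M[R[i]]_n}) : Prop :=
  forall a b : 'M[R[i]]_n, D (a *m b) = D a *m b + a *m D b.

Definition star_derivation (R : realType) (n : nat)
    (D : {linear 'M[R[i]]_n -> 'M[R[i]]_n}) : Prop :=
  derivation D /\ forall a : 'M[R[i]]_n, D (a^t*) = (D a)^t*.

Definition bounded_functional (R : realType) (n : nat)
    (phi : {scalar 'M[R[i]]_n}) : Prop :=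
  exists K : R, forall a : 'M[R[i]]_n, normc (phi a) <= K * opnorm a.

Definition weak_2_local_star_derivation (R : realType) (n : nat)
    (Delta : 'M[R[i]]_n -> 'M[R[i]]_n) : Prop :=
  forall (a b : 'M[R[i]]_n) (phi : {scalar 'M[R[i]]_n}),
    bounded_functional phi ->
    exists D : {linear 'M[R[i]]_n -> 'M[R[i]]_n},
      [/\ star_derivation D,
          phi (Delta a) = phi (D a) & phi (Delta b) = phi (D b)].

(* Main.v *)
Require Import Defs.
From mathcomp Require Import all_boot all_order all_algebra.
From mathcomp Require Import complex.
From mathcomp Require Import all_classical all_reals all_analysis.

(** Pairing with the trace, a derivation [D] of [M_n] satisfies
    [tr (a D(a)) = 0]: twice this number is [tr (D (a^2))], and the trace
    vanishes on the range of [D].  A weak-2-local *-derivation [Delta]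
    inherits the identity at a single point ([trace_mul_Delta]) and, applied to
    the pair [a, b] with the functional [x |-> tr ((a - b) x)], yields
    [tr ((a - b) (Delta a - Delta b)) = 0].  Polarizing, [Delta] is
    skew-adjoint for the trace pairing ([trace_Delta_skew]):
    [tr (a (Delta b)) = - tr (b (Delta a))].

    Boundedness follows at once.  The entry [(i, j)] of [Delta p] is the pairing
    of [Delta p] with the matrix unit [e_ji], hence equals
    [- tr (p (Delta e_ji))]; this is a combination of the entries of the fixed
    matrix [Delta e_ji] with the entries of [p] as coefficients, and the entries
    of a projection have modulus at most 1.  The bound on entries turns into a
    bound on the C*-norm because [opnorm a] lies between each [|a i j|] and
    their sum ([normc_entry_le_opnorm], [opnorm_le_entries]); the first of these
    inequalities also shows that the functionals used above are bounded. *)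

Import Order.TTheory GRing.Theory Num.Theory.
Import ComplexField.Normc.

Local Open Scope classical_set_scope.
Local Open Scope ring_scope.
Local Open Scope complex_scope.

Lemma normc_ge0 (R : rcfType) (x : R[i]) : 0 <= normc x.
Proof. by case: x => x y; exact: sqrtr_ge0. Qed.

Lemma normc_sum (R : rcfType) (I : finType) (F : I -> R[i]) :
  normc (\sum_i F i) <= \sum_i normc (F i).
Proof.
apply: (big_ind2 (fun x y => normc x <= y)) => [|x1 x2 y1 y2 le1 le2|//].
  by rewrite normc0.
exact: le_trans (le_normcD _ _) (lerD le1 le2).
Qed.

Lemma mulC_conj_normc (R : rcfType) (x : R[i]) :
  x * x^* = (normc x ^+ 2)%:C.
Proof. by rewrite -normCK rmorphXn. Qed.

Lemma normc_real_ge0 (R : rcfType) (x : R) : 0 <= x -> normc x%:C = x.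
Proof.
by move=> x_ge0; rewrite /= [0 ^+ 2]expr0n addr0 sqrtr_sqr ger0_norm.
Qed.

Lemma normc_entry_le_l2norm (R : realType) (n : nat) (v : 'cV[R[i]]_n) i :
  normc (v i 0) <= l2norm v.
Proof.
rewrite -[leLHS]ger0_norm ?normc_ge0 // -sqrtr_sqr ler_wsqrtr //.
rewrite (bigD1 i) //= lerDl sumr_ge0 // => j _.
by rewrite exprn_ge0 ?normc_ge0.
Qed.

Lemma l2norm_le_sum (R : realType) (n : nat) (v : 'cV[R[i]]_n) :
  l2norm v <= \sum_i normc (v i 0).
Proof.
have sum_ge0 : 0 <= \sum_i normc (v i 0).
  by apply: sumr_ge0 => i _; exact: normc_ge0.
rewrite -[leRHS]ger0_norm // -sqrtr_sqr ler_wsqrtr //.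
rewrite [leRHS]expr2 mulr_suml; apply: ler_sum => i _.
rewrite expr2 ler_wpM2l ?normc_ge0 // (bigD1 i) //= lerDl.
by apply: sumr_ge0 => j _; exact: normc_ge0.
Qed.

Lemma l2norm_mulmx_le (R : realType) (n : nat) (a : 'M[R[i]]_n) v :
  l2norm v <= 1 -> l2norm (a *m v) <= \sum_i \sum_j normc (a i j).
Proof.
move=> v_le1; apply: le_trans (l2norm_le_sum _ _ _) _.
apply: ler_sum => i _; rewrite mxE; apply: le_trans (normc_sum _ _ _) _.
apply: ler_sum => j _; rewrite normcM ler_piMr ?normc_ge0 //.
exact: le_trans (normc_entry_le_l2norm _ _ _ _) v_le1.
Qed.

Lemma opnorm_le_entries (R : realType) (n : nat) (a : 'M[R[i]]_n) :
  opnorm a <= \sum_i \sum_j normc (a i j).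
Proof.
apply: ge_sup => [|_ [v v_le1 <-]]; last exact: l2norm_mulmx_le.
exists (l2norm (a *m 0)), 0 => //=; rewrite /l2norm big1 ?sqrtr0 // => i _.
by rewrite mxE normc0 expr0n.
Qed.

(** The vector [delta_mx j 0] lies in the unit ball, and [a] maps it to the
    [j]-th column of [a]. *)
Lemma normc_entry_le_opnorm (R : realType) (n : nat) (a : 'M[R[i]]_n) i j :
  normc (a i j) <= opnorm a.
Proof.
have -> : a i j = (a *m delta_mx j 0 : 'cV__) i 0 by rewrite -colE mxE.
apply: le_trans (normc_entry_le_l2norm _ _ _ _) _.
apply: ub_le_sup.
  by exists (\sum_i \sum_j normc (a i j)) => _ [v v_le1 <-]; exact: l2norm_mulmx_le.
exists (delta_mx j 0) => //=; apply: le_trans (l2norm_le_sum _ _ _) _.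
rewrite (bigD1 j) //= mxE !eqxx normc1 big1 ?addr0 // => k k_neq_j.
by rewrite mxE (negbTE k_neq_j) normc0.
Qed.

(** In [p = p p^*] the [k]-th diagonal entry [p k k] is the sum [S] of the
    [|p k l|^2]; since [S] is at least [|p k k|^2 = S^2], it is at most 1. *)
Lemma normc_projection_le1 (R : realType) (n : nat) (p : 'M[R[i]]_n) k l :
  projection p -> normc (p k l) <= 1.
Proof.
move=> [p_adj p_idem]; pose S := \sum_j normc (p k j) ^+ 2.
have S_ge0 : 0 <= S by apply: sumr_ge0 => j _; rewrite exprn_ge0 ?normc_ge0.
have le_S j : normc (p k j) ^+ 2 <= S.
  rewrite /S (bigD1 j) //= lerDl sumr_ge0 // => i _.
  by rewrite exprn_ge0 ?normc_ge0.
have pkk : p k k = S%:C.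
  rewrite p_idem {2}p_adj mxE rmorph_sum; apply: eq_bigr => j _.
  by rewrite !mxE mulC_conj_normc.
have S_le1 : S <= 1.
  rewrite leNgt; apply/negP => S_gt1; have := le_S k.
  rewrite pkk normc_real_ge0 // expr2 leNgt ltr_pMr //.
    by rewrite S_gt1.
  exact: lt_trans S_gt1.
rewrite -(@ler_pXn2r _ 2) ?nnegrE ?normc_ge0 // expr1n.
exact: le_trans (le_S l) S_le1.
Qed.

Lemma trace_mul_delta (F : comPzRingType) (n : nat) (a : 'M[F]_n) i j :
  \tr (a *m delta_mx j i) = a i j.
Proof.
rewrite -(mul_delta_mx (0 : 'I_1)) mulmxA mxtrace_mulC mulmxA.
by rewrite trace_mx11 -colE -rowE !mxE.
Qed.

Lemma trace_mulE (F : pzRingType) (n : nat) (a b : 'M[F]_n) :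
  \tr (a *m b) = \sum_i \sum_j a i j * b j i.
Proof. by apply: eq_bigr => i _; rewrite mxE. Qed.

(** [x |-> tr (D x)] vanishes on commutators, so it is a multiple of the trace;
    the multiple is zero because [D 1 = 0]. *)
Lemma trace_derivation (R : realType) (n : nat)
    (D : {linear 'M[R[i]]_n -> 'M[R[i]]_n}) (x : 'M[R[i]]_n) :
  derivation D -> \tr (D x) = 0.
Proof.
move=> derD.
have trDC a b : \tr (D (a *m b)) = \tr (D (b *m a)).
  by rewrite !derD !mxtraceD [LHS]addrC; congr (_ + _); exact: mxtrace_mulC.
have D1 : D 1%:M = 0.
  have := derD 1%:M 1%:M; rewrite !mulmx1 mul1mx -[LHS]addr0.
  by move/addrI.
have diag i j : \tr (D (delta_mx i i)) = \tr (D (delta_mx j j)).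
  by rewrite -(mul_delta_mx j) trDC mul_delta_mx.
have unit_mx i j : \tr (D (delta_mx i j)) = 0.
  have [<-|ij] := eqVneq i j; last first.
    by rewrite -(mul_delta_mx i) trDC mul_delta_mx_0 ?linear0 ?mxtrace0 // eq_sym.
  have : \tr (D 1%:M) = 0 by rewrite D1 mxtrace0.
  rewrite mx1_sum_delta !linear_sum /= (eq_bigr _ (fun k _ => diag k i)).
  rewrite sumr_const card_ord => /eqP; rewrite mulrn_eq0.
  (* The existence of the index [i] makes [n] nonzero. *)
  by rewrite gtn_eqF ?(leq_ltn_trans _ (ltn_ord i)) //= => /eqP.
rewrite (matrix_sum_delta x) !linear_sum big1 //= => i _.
rewrite !linear_sum big1 //= => j _.
by rewrite !linearZ /= unit_mx mulr0.
Qed.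

(** [a D(a)] and [D(a) a] have the same trace and add up to [D (a^2)]. *)
Lemma trace_mul_derivation (R : realType) (n : nat)
    (D : {linear 'M[R[i]]_n -> 'M[R[i]]_n}) (a : 'M[R[i]]_n) :
  derivation D -> \tr (a *m D a) = 0.
Proof.
move=> derD; have := trace_derivation R n D (a *m a) derD.
rewrite derD mxtraceD mxtrace_mulC -mulr2n => /eqP.
by rewrite mulrn_eq0 => /eqP.
Qed.

Definition trace_functional (R : realType) (n : nat) (h : 'M[R[i]]_n) :
  {scalar 'M[R[i]]_n} := mxtrace \o mulmx h.

Lemma bounded_trace_functional (R : realType) (n : nat) (h : 'M[R[i]]_n) :
  bounded_functional (trace_functional R n h).
Proof.
exists (\sum_i \sum_j normc (h i j)) => a; rewrite /= trace_mulE.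
apply: le_trans (normc_sum _ _ _) _; rewrite mulr_suml.
apply: ler_sum => i _; apply: le_trans (normc_sum _ _ _) _; rewrite mulr_suml.
apply: ler_sum => j _; rewrite normcM ler_wpM2l ?normc_ge0 //.
exact: normc_entry_le_opnorm.
Qed.

Lemma trace_mul_Delta (R : realType) (n : nat)
    (Delta : 'M[R[i]]_n -> 'M[R[i]]_n) (a : 'M[R[i]]_n) :
  weak_2_local_star_derivation Delta -> \tr (a *m Delta a) = 0.
Proof.
move=> hDelta.
have [D [[derD _] /= -> _]] := hDelta a a _ (bounded_trace_functional R n a).
exact: trace_mul_derivation.
Qed.

(** One derivation [D] represents [Delta] at both [a] and [b] for the functional
    [x |-> tr ((a - b) x)], so that [tr ((a - b) (Delta a - Delta b))] equals
    [tr ((a - b) D(a - b)) = 0]; expanding leaves the two mixed terms. *)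
Lemma trace_Delta_skew (R : realType) (n : nat)
    (Delta : 'M[R[i]]_n -> 'M[R[i]]_n) (a b : 'M[R[i]]_n) :
  weak_2_local_star_derivation Delta ->
  \tr (a *m Delta b) = - \tr (b *m Delta a).
Proof.
move=> hDelta.
have : \tr ((a - b) *m Delta a) - \tr ((a - b) *m Delta b) = 0.
  have [D [[derD _] /= -> ->]] :=
    hDelta a b _ (bounded_trace_functional R n (a - b)).
  by rewrite -linearB -mulmxBr -linearB /= trace_mul_derivation.
rewrite !mulmxBl ![\tr (_ - _)]linearB /= !(trace_mul_Delta R n Delta) // sub0r subr0.
by move/eqP; rewrite subr_eq0 => /eqP <-.
Qed.

Theorem proposition3p10 (R : realType) (n : nat)
    (Delta : 'M[R[i]]_n -> 'M[R[i]]_n)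
    (hDelta : weak_2_local_star_derivation Delta) :
  (ereal_sup [set (opnorm (Delta p))%:E | p in [set p | projection p]] < +oo)%E.
Proof.
pose M := \sum_i \sum_j \sum_k \sum_l normc (Delta (delta_mx j i) l k).
apply: (@le_lt_trans _ _ M%:E); last exact: ltry.
apply: ge_ereal_sup => _ [p p_proj <-]; rewrite lee_fin.
apply: le_trans (opnorm_le_entries _ _ _) _.
apply: ler_sum => i _; apply: ler_sum => j _.
rewrite -trace_mul_delta mxtrace_mulC trace_Delta_skew // normcN trace_mulE.
apply: le_trans (normc_sum _ _ _) _; apply: ler_sum => k _.
apply: le_trans (normc_sum _ _ _) _; apply: ler_sum => l _.
by rewrite normcM ler_piMl ?normc_ge0 ?normc_projection_le1.
Qed.
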